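(* For every integer $n\geqslant1$, the $4$-point correlation function $\eta^{(4)}$ of the Rudin--Shapiro sequence with balanced weights is constant on the set $\mathcal{C}_n\subset\mathbb{Z}^3$ consisting of all vectors $$2^{m}\bigl(1,\,2^{n}(2\ell+1),\,2^{n}(2\ell+1)+1\bigr),\qquad m\geqslant0\ (m\in\mathbb{Z}),\ \ell\in\mathbb{Z},$$ and all permutations of their coordinates, and its value there is $$\eta^{(4)}\big|_{\mathcal{C}_n}=1-\frac{3}{2^{n}}.$$
   Context: The binary (balanced) Rudin--Shapiro sequence is any bi-infinite word $w=(w_i)_{i\in\mathbb{Z}}\in\{1,-1\}^{\mathbb{Z}}$ satisfying, for all $m\in\mathbb{Z}$, $w_{4m+\ell}=w_m$ for $\ell\in\{0,1\}$ and $w_{4m+\ell}=(-1)^{m+\ell}w_m$ for $\ell\in\{2,3\}$. Its $4$-point correlation function is $$\eta^{(4)}(m_1,m_2,m_3)=\lim_{N\to\infty}\frac{1}{2N+1}\sum_{i=-N}^{N}w_iw_{i+m_1}w_{i+m_2}w_{i+m_3},\qquad (m_1,m_2,m_3)\in\mathbb{Z}^3;$$ the limits exist and do not depend on the choice of $w$. *)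

(* Defs.v *)
From mathcomp Require Import all_boot all_order all_algebra.
From mathcomp Require Import all_classical all_reals all_analysis.
Set Implicit Arguments.
Unset Strict Implicit.
Unset Printing Implicit Defensive.
Import Order.TTheory GRing.Theory Num.Theory.
Import numFieldNormedType.Exports.
Local Open Scope classical_set_scope.
Local Open Scope ring_scope.

(* [(-1) ^ k] is the integer power of ssrint, so it is the sign [1] or [-1]
   according to the parity of [k], also for negative [k]. *)
Definition rudin_shapiro (R : realType) (w : int -> R) : Prop :=
  (forall i : int, w i = 1 \/ w i = -1) /\
  forall m l : int,
    (l = 0 \/ l = 1 -> w (4 * m + l) = w m) /\
    (l = 2 \/ l = 3 -> w (4 * m + l) = (-1) ^ (m + l) * w m).

(* The index [j < 2N + 1] stands for the integer [i = j - N], so that [i] runs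
   through [-N, ..., N]. *)
Definition avg4 (R : realType) (w : int -> R) (m1 m2 m3 : int) (N : nat) : R :=
  (2 * N + 1)%N%:R^-1 *
  \sum_(j < 2 * N + 1)
    (let i : int := (j : nat)%:Z - N%:Z in
     w i * w (i + m1) * w (i + m2) * w (i + m3)).

(* [limn] returns a default value on divergent sequences: statements about
   [eta4] must be accompanied by [cvgn (avg4 w m1 m2 m3)]. *)
Definition eta4 (R : realType) (w : int -> R) (m1 m2 m3 : int) : R :=
  limn (avg4 w m1 m2 m3).

Definition C (n : nat) : set (int * int * int) :=
  [set v | exists (m : nat) (l : int),
     perm_eq [:: v.1.1; v.1.2; v.2]
       [seq 2 ^+ m * x | x <- [:: 1; 2 ^+ n * (2 * l + 1);
                                  2 ^+ n * (2 * l + 1) + 1]]].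

(* Main.v *)
Require Import Defs.
From mathcomp Require Import all_boot all_order all_algebra.
From mathcomp Require Import all_classical all_reals all_analysis.
From mathcomp Require Import ring zify.
Set Implicit Arguments.
Unset Strict Implicit.
Import Order.TTheory GRing.Theory Num.Theory.
Import numFieldNormedType.Exports.
Local Open Scope classical_set_scope.
Local Open Scope ring_scope.

(** Put [u i = w i * w (i + 1)] and [v i = w i * w (i + 2)]. On the residues mod
    4 the word [u] takes the values [1], [(-1) ^ m], [-1], [- (-1) ^ m * u m] at
    [4 m + l], so summing [u i * u (i + b)] over blocks of length 4 gives, for
    the mean [E b]: [E b = 0] for odd [b] and [E (4 d + 2) = -1/2], since the
    remaining terms have the form [f (m + d) - f m] and telescope, and
    [E (4 b) = (2 + (-1) ^ b * (1 + E b)) / 4]. This yields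
    [E (2 ^ n * (2 l + 1)) = 1 - 3 / 2 ^ n], the case [m = 0]. Likewise the mean
    of [v i * v (i + 4 b)] is [(-1) ^ b * (1 + E b) / 2], which is the case
    [m = 1], and multiplying all shifts by 4 does not change the correlation
    when their sum is even. Steps of 4 are used because [w (2 m) = w m] may fail
    for negative [m]. *)

(** * Means with bounded discrepancy *)

(* All the means here are attained with a bounded error, uniformly over the
   windows; this is stronger than convergence, but it is stable under sums,
   shifts and splitting into blocks with no side condition on the rate. *)
Definition bounded_discrepancy (R : realType) (f : int -> R) (c : R) : Prop :=
  exists K : R, forall (a : int) (N : nat),
    `|\sum_(j < N) (f (a + (j : nat)%:Z) - c)| <= K.

Lemma bounded_discrepancy_cst (R : realType) (c : R) :
  bounded_discrepancy (fun=> c) c.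
Proof. by exists 0 => a N; rewrite big1 ?normr0// => i _; rewrite subrr. Qed.

Lemma bounded_discrepancyD (R : realType) (f g : int -> R) (c d : R) :
  bounded_discrepancy f c -> bounded_discrepancy g d ->
  bounded_discrepancy (fun i => f i + g i) (c + d).
Proof.
move=> [K fK] [L gL]; exists (K + L) => a N.
under eq_bigr do rewrite opprD addrACA.
by rewrite big_split (le_trans (ler_normD _ _))// lerD.
Qed.

Lemma bounded_discrepancyZ (R : realType) (f : int -> R) (c x : R) :
  bounded_discrepancy f c ->
  bounded_discrepancy (fun i => x * f i) (x * c).
Proof.
move=> [K fK]; exists (`|x| * K) => a N.
under eq_bigr do rewrite -mulrBr.
by rewrite -mulr_sumr normrM ler_wpM2l.
Qed.

Lemma bounded_discrepancy_shift (R : realType) (f : int -> R) (c : R) (e : int) :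
  bounded_discrepancy f c -> bounded_discrepancy (fun i => f (i + e)) c.
Proof.
move=> [K fK]; exists K => a N.
by under eq_bigr do rewrite addrAC; apply: fK.
Qed.

Lemma eq_bounded_discrepancy (R : realType) (f g : int -> R) (c d : R) :
  f =1 g -> c = d -> bounded_discrepancy f c -> bounded_discrepancy g d.
Proof. by move=> /funext-> ->. Qed.

(** For [d = 1] a window sum collapses to two boundary values, hence is at most 2 in absolute value.
    Any other [d] is a finite sum of shifts of this case, negated when [d] is negative. *)
Lemma bounded_discrepancy_telescope (R : realType) (v : int -> R) (d : int) :
  (forall i, `|v i| <= 1) ->
  bounded_discrepancy (fun i => v (i + d) - v i) 0.
Proof.
move=> v1.
have step : bounded_discrepancy (fun i => v (i + 1) - v i) 0.
  exists 2 => a N.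
  have -> : \sum_(j < N) (v (a + (j : nat)%:Z + 1) - v (a + (j : nat)%:Z) - 0) =
            v (a + N%:Z) - v a.
    elim: N => [|N IH]; first by rewrite big_ord0 addr0 subrr.
    rewrite big_ord_recr /= IH (_ : a + N.+1%:Z = a + N%:Z + 1); last by lia.
    ring.
  by rewrite (le_trans (ler_normB _ _))// (_ : 2 = 1 + 1)// lerD.
elim: d => [|n IH|n IH].
- apply: eq_bounded_discrepancy (bounded_discrepancy_cst 0) => // i.
  by rewrite addr0 subrr.
- apply: eq_bounded_discrepancy (bounded_discrepancyD IH
    (bounded_discrepancy_shift n%:Z step)) => [i|]; last by rewrite addr0.
  rewrite (_ : i + n.+1%:Z = i + n%:Z + 1); last by lia.
  ring.
- apply: eq_bounded_discrepancy (bounded_discrepancyD IH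
    (bounded_discrepancyZ (-1)
       (bounded_discrepancy_shift (- n.+1%:Z) step))) => [i|].
    have -> : i - n.+1%:Z + 1 = i - n%:Z by lia.
    ring.
  by rewrite mulr0 addr0.
Qed.

(** A window differs from a union of aligned blocks of length [q] by fewer than [q] terms at each
    end, and each such end costs at most [q * (1 + |c|)]. *)
Lemma bounded_discrepancy_blocks (R : realType) (q : nat) (f : int -> R) (c : R) :
  (0 < q)%N -> (forall i, `|f i| <= 1) ->
  bounded_discrepancy (fun k => \sum_(l < q) f (q%:Z * k + (l : nat)%:Z)) (q%:R * c) ->
  bounded_discrepancy f c.
Proof.
move=> q0 f1 [K fK].
pose T (a : int) (N : nat) := \sum_(j < N) (f (a + (j : nat)%:Z) - c).
have TD a M N : T a (M + N)%N = T a M + T (a + M%:Z) N.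
  rewrite /T big_split_ord; congr (_ + _); apply: eq_bigr => j _ /=.
  by rewrite PoszD addrA.
have Tshort a r : (r < q)%N -> `|T a r| <= q%:R * (1 + `|c|).
  move=> rq; apply: (le_trans (ler_norm_sum _ _ _)).
  apply: (@le_trans _ _ (\sum_(j < r) (1 + `|c|))).
    by apply: ler_sum => j _; rewrite (le_trans (ler_normB _ _))// lerD.
  rewrite sumr_const card_ord -[leLHS]mulr_natl; apply: ler_wpM2r.
    by rewrite addr_ge0.
  by rewrite ler_nat ltnW.
have Tlong b M : `|T (q%:Z * b) (M * q)%N| <= K.
  suff -> : T (q%:Z * b) (M * q)%N = \sum_(j < M)
      (\sum_(l < q) f (q%:Z * (b + (j : nat)%:Z) + (l : nat)%:Z) - q%:R * c) by [].
  elim: M => [|M IH]; first by rewrite mul0n /T !big_ord0.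
  rewrite mulSn addnC TD IH big_ord_recr /=; congr (_ + _).
  rewrite /T sumrB sumr_const card_ord mulr_natl; congr (_ - _).
  by apply: eq_bigr => l _; congr f; rewrite mulrDr PoszM; ring.
exists (K + q%:R * (1 + `|c|) + q%:R * (1 + `|c|)) => a N; rewrite -/(T a N).
pose b := (a %/ q%:Z)%Z; pose r := `|(a %% q%:Z)%Z|%N.
have q_neq0 : q%:Z != 0 by lia.
have rE : r%:Z = (a %% q%:Z)%Z by rewrite /r; have := modz_ge0 a q_neq0; lia.
have rq : (r < q)%N.
  by have := @ltz_pmod a q%:Z; rewrite -rE; lia.
have aE : a = q%:Z * b + r%:Z by rewrite rE mulrC -divz_eq.
(* The window is extended back to the multiple [q * b] preceding [a], and the added head is
   subtracted. *)
have -> : T a N = T (q%:Z * b) (r + N)%N - T (q%:Z * b) r.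
  by rewrite TD -aE addrAC subrr add0r.
rewrite (divn_eq (r + N) q) TD.
apply: (le_trans (ler_normB _ _)); apply: lerD; last exact: Tshort.
apply: (le_trans (ler_normD _ _)); apply: lerD; first exact: Tlong.
by apply: Tshort; rewrite ltn_pmod.
Qed.

(** The error of the average is at most [K / (2 N + 1)], which is below [K / (N + 1)]. *)
Lemma bounded_discrepancy_cvg (R : realType) (f : int -> R) (c : R) :
  bounded_discrepancy f c ->
  (fun N : nat => (2 * N + 1)%N%:R^-1 *
     \sum_(j < 2 * N + 1) f ((j : nat)%:Z - N%:Z)) @ \oo --> c.
Proof.
move=> [K fK].
have K0 : 0 <= K by have := fK 0 0%N; rewrite big_ord0 normr0.
have cvgK : (fun N : nat => K * harmonic N) @ \oo --> (0 : R).
  by rewrite -[X in _ --> X](mulr0 K); apply: cvgMl_tmp; exact: cvg_harmonic.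
apply/cvgrPdistC_le => e e0; near=> N.
have N0 : (0 : R) < (2 * N + 1)%:R by rewrite ltr0n addn1.
set S := \sum_(j < _) _.
have -> : (2 * N + 1)%:R^-1 * S - c = (2 * N + 1)%:R^-1 *
    \sum_(j < 2 * N + 1) (f (- N%:Z + (j : nat)%:Z) - c).
  rewrite sumrB sumr_const card_ord mulrBr -[X in _ - _ * X]mulr_natl mulKf ?gt_eqF//.
  by congr (_ * _ - _); apply: eq_bigr => j _; rewrite addrC.
rewrite normrM gtr0_norm ?invr_gt0//.
apply: (@le_trans _ _ (K * harmonic N)); last first.
  near: N; move/cvgr_le : cvgK; exact.
rewrite mulrC; apply: ler_pM => //; rewrite ?invr_ge0 ?ler0n//.
by rewrite /harmonic lef_pV2 ?posrE// ?ltr0n// ler_nat; lia.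
Unshelve. all: by end_near. Qed.

(** * The Rudin-Shapiro recursion on blocks of length 4 *)

Section rudin_shapiro_correlations.
Variables (R : realType) (w : int -> R).
Hypothesis wRS : rudin_shapiro w.

Let sg (k : int) : R := (-1) ^ k.
Let u (i : int) : R := w i * w (i + 1).
(** The shifts form a list, so that permuting coordinates only reorders a product. *)
Let corr4 (s : seq int) (c : R) : Prop :=
  bounded_discrepancy (fun i => w i * \prod_(x <- s) w (i + x)) c.

Lemma sgD m n : sg (m + n) = sg m * sg n.
Proof. by rewrite /sg expfzDr// oppr_eq0 oner_eq0. Qed.

Lemma sgsg m : sg m * sg m = 1.
Proof. by rewrite /sg -expfzMl mulrNN mulr1 exp1rz. Qed.

Lemma sg2 m : sg (2 * m) = 1.
Proof. by rewrite mulrDl mul1r sgD sgsg. Qed.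

Lemma sg1 : sg 1 = -1. Proof. by []. Qed.

Lemma norm_sg m : `|sg m| <= 1.
Proof.
have /eqP : sg m ^+ 2 = 1 by rewrite expr2 sgsg.
by rewrite sqrf_eq1 => /orP[] /eqP ->; rewrite ?normrN normr1.
Qed.

Lemma norm_w i : `|w i| <= 1.
Proof. by case: wRS => /(_ i)[] -> _; rewrite ?normrN normr1. Qed.

Lemma ww i : w i * w i = 1.
Proof. by case: wRS => /(_ i)[] -> _; rewrite ?mulrNN mulr1. Qed.

Lemma normM_le1 (x y : R) : `|x| <= 1 -> `|y| <= 1 -> `|x * y| <= 1.
Proof. by move=> x1 y1; rewrite normrM mulr_ile1. Qed.

Lemma norm_u i : `|u i| <= 1.
Proof. by apply: normM_le1; apply: norm_w. Qed.

Lemma w4 m : [/\ w (4 * m) = w m, w (4 * m + 1) = w m,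
  w (4 * m + 2) = sg m * w m & w (4 * m + 3) = - (sg m * w m)].
Proof.
case: wRS => _ h; split.
- by rewrite -[4 * m]addr0 (h m 0).1//; left.
- by rewrite (h m 1).1//; right.
- by rewrite (h m 2).2; [rewrite -/(sg _) (sgD m 2) (sg2 1) mulr1|left].
- rewrite (h m 3).2; [|by right].
  by rewrite -/(sg _) (sgD m 3) (sgD 2 1) (sg2 1) sg1; ring.
Qed.

Lemma u4 m : [/\ u (4 * m) = 1, u (4 * m + 1) = sg m,
  u (4 * m + 2) = -1 & u (4 * m + 3) = - (sg m * u m)].
Proof.
have [w0 w1 w2 w3] := w4 m; have [w4' _ _ _] := w4 (m + 1).
rewrite /u (_ : 4 * m + 3 + 1 = 4 * (m + 1)); last by ring.
rewrite (_ : 4 * m + 2 + 1 = 4 * m + 3); last by ring.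
rewrite (_ : 4 * m + 1 + 1 = 4 * m + 2); last by ring.
rewrite w4' w0 w1 w2 w3.
split; [exact: ww| | |by ring].
- by rewrite mulrCA ww mulr1.
- by rewrite mulrN mulrACA ww sgsg mulr1.
Qed.

(** * Correlations of [u] *)

(** An odd shift pairs the even residues, where [u] is constant, with the odd ones, where it is [sg]
    or [- sg * u]. The four products form two differences, one of [sg] and one of [su]. *)
Lemma corr_u_odd (l : int) :
  bounded_discrepancy (fun i => u i * u (i + (2 * l + 1))) 0.
Proof.
apply: (@bounded_discrepancy_blocks R 4) => // [i|].
  by apply: normM_le1; apply: norm_u.
pose su i := sg i * u i.
have su1 i : `|su i| <= 1 by apply: normM_le1; [exact: norm_sg|exact: norm_u].
have [d [->|->]] : exists d : int, l = 2 * d \/ l = 2 * d + 1.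
  by exists (l %/ 2)%Z; lia.
- apply: eq_bounded_discrepancy (bounded_discrepancyD
    (bounded_discrepancy_telescope d norm_sg)
    (bounded_discrepancy_telescope d su1)) => [m|]; last by rewrite mulr0 addr0.
  rewrite !big_ord_recr big_ord0 /= add0r.
  have [a0 a1 a2 a3] := u4 m; have [b0 b1 b2 b3] := u4 (m + d).
  have [c0 _ _ _] := u4 (m + d + 1).
  rewrite addr0 a0 a1 a2 a3.
  rewrite (_ : 4%:Z * m + (2 * (2 * d) + 1) = 4 * (m + d) + 1); last by ring.
  rewrite (_ : 4%:Z * m + 1 + (2 * (2 * d) + 1) = 4 * (m + d) + 2); last by ring.
  rewrite (_ : 4%:Z * m + 2 + (2 * (2 * d) + 1) = 4 * (m + d) + 3); last by ring.
  rewrite (_ : 4%:Z * m + 3 + (2 * (2 * d) + 1) = 4 * (m + d + 1)); last by ring.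
  by rewrite b1 b2 b3 c0 /su; ring.
- apply: eq_bounded_discrepancy (bounded_discrepancyZ (-1) (bounded_discrepancyD
    (bounded_discrepancy_telescope (d + 1) norm_sg)
    (bounded_discrepancy_telescope d su1))) => [m|]; last by rewrite !mulr0 addr0 mulr0.
  rewrite !big_ord_recr big_ord0 /= add0r.
  have [a0 a1 a2 a3] := u4 m; have [b0 b1 b2 b3] := u4 (m + d).
  have [c0 c1 c2 _] := u4 (m + d + 1).
  rewrite addr0 a0 a1 a2 a3.
  rewrite (_ : 4%:Z * m + (2 * (2 * d + 1) + 1) = 4 * (m + d) + 3); last by ring.
  rewrite (_ : 4%:Z * m + 1 + (2 * (2 * d + 1) + 1) = 4 * (m + d + 1)); last by ring.
  rewrite (_ : 4%:Z * m + 2 + (2 * (2 * d + 1) + 1) = 4 * (m + d + 1) + 1); last by ring.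
  rewrite (_ : 4%:Z * m + 3 + (2 * (2 * d + 1) + 1) = 4 * (m + d + 1) + 2); last by ring.
  by rewrite b3 c0 c1 c2 /su (addrA m d 1); ring.
Qed.

(** Residues 0 and 2 are exchanged and give -1 each; residues 1 and 3 together give
    [- sg d * (u (m + d) - u m)]. *)
Lemma corr_u_4d2 (d : int) :
  bounded_discrepancy (fun i => u i * u (i + (4 * d + 2))) (- 2^-1).
Proof.
apply: (@bounded_discrepancy_blocks R 4) => // [i|].
  by apply: normM_le1; apply: norm_u.
apply: eq_bounded_discrepancy (bounded_discrepancyD
  (bounded_discrepancy_cst (-2)) (bounded_discrepancyZ (- sg d)
  (bounded_discrepancy_telescope d norm_u))) => [m|]; last by field.
rewrite !big_ord_recr big_ord0 /= add0r.
have [a0 a1 a2 a3] := u4 m; have [_ _ b2 b3] := u4 (m + d).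
have [c0 c1 _ _] := u4 (m + d + 1).
rewrite addr0 a0 a1 a2 a3.
rewrite (_ : 4%:Z * m + (4 * d + 2) = 4 * (m + d) + 2); last by ring.
rewrite (_ : 4%:Z * m + 1 + (4 * d + 2) = 4 * (m + d) + 3); last by ring.
rewrite (_ : 4%:Z * m + 2 + (4 * d + 2) = 4 * (m + d + 1)); last by ring.
rewrite (_ : 4%:Z * m + 3 + (4 * d + 2) = 4 * (m + d + 1) + 1); last by ring.
rewrite b2 b3 c0 c1 !sgD sg1.
by ring: (sgsg m).
Qed.

(** Residues are preserved: 0 and 2 give 1 each, 1 gives [sg b], and 3 gives
    [sg b * (u m * u (m + b))]. *)
Lemma corr_u_4b (b : int) (c : R) :
  bounded_discrepancy (fun i => u i * u (i + b)) c ->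
  bounded_discrepancy (fun i => u i * u (i + 4 * b))
    ((2 + sg b * (1 + c)) / 4).
Proof.
move=> h; apply: (@bounded_discrepancy_blocks R 4) => // [i|].
  by apply: normM_le1; apply: norm_u.
apply: eq_bounded_discrepancy (bounded_discrepancyD
  (bounded_discrepancy_cst (2 + sg b)) (bounded_discrepancyZ (sg b) h))
  => [m|]; last by field.
rewrite !big_ord_recr big_ord0 /= add0r.
have [a0 a1 a2 a3] := u4 m; have [b0 b1 b2 b3] := u4 (m + b).
rewrite addr0 ![_ + _ + 4 * b]addrAC -mulrDr a0 a1 a2 a3 b0 b1 b2 b3 !sgD.
by ring: (sgsg m).
Qed.

Lemma corr_u_pow (n : nat) (l : int) :
  bounded_discrepancy (fun i => u i * u (i + 2 ^+ n.+1 * (2 * l + 1)))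
    (1 - 3 / 2 ^+ n.+1).
Proof.
(* The recursion multiplies the shift by 4, so the exponent drops by two and both exponents 1 and 2
   are base cases. *)
have [k] := ubnP n; elim: k n l => // k IH [|[|n]] l nk.
- apply: eq_bounded_discrepancy (corr_u_4d2 l) => [i|]; last by field.
  by congr (_ * u (_ + _)); ring.
- apply: eq_bounded_discrepancy (corr_u_4b (corr_u_odd l)) => [i|].
    by congr (_ * u (_ + _)); ring.
  by rewrite sgD sg2 sg1; field.
- apply: eq_bounded_discrepancy (corr_u_4b (IH n l _)) => [i||]; last by lia.
    by rewrite (exprS _ n.+2) (exprS _ n.+1) !mulrA.
  rewrite (exprS _ n) -mulrA sg2 !exprS; field.
  by rewrite expf_neq0 ?pnatr_eq0.
Qed.

(** * Correlations of [v] *)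

Let v (i : int) : R := w i * w (i + 2).

Lemma v4 m : [/\ v (4 * m) = sg m, v (4 * m + 1) = - sg m,
  v (4 * m + 2) = sg m * u m & v (4 * m + 3) = - (sg m * u m)].
Proof.
have [w0 w1 w2 w3] := w4 m; have [w4' w5 _ _] := w4 (m + 1).
rewrite /v (_ : 4 * m + 3 + 2 = 4 * (m + 1) + 1); last by ring.
rewrite (_ : 4 * m + 2 + 2 = 4 * (m + 1)); last by ring.
rewrite (_ : 4 * m + 1 + 2 = 4 * m + 3); last by ring.
rewrite w4' w5 w0 w1 w2 w3 /u mulrN mulrCA ww mulr1.
by split => //; ring.
Qed.

Lemma corr_v_4b (b : int) (c : R) :
  bounded_discrepancy (fun i => u i * u (i + b)) c ->
  bounded_discrepancy (fun i => v i * v (i + 4 * b)) (sg b * (1 + c) / 2).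
Proof.
move=> h; apply: (@bounded_discrepancy_blocks R 4) => // [i|].
  by do 2!apply: normM_le1; apply: norm_w.
apply: eq_bounded_discrepancy (bounded_discrepancyD
  (bounded_discrepancy_cst (2 * sg b)) (bounded_discrepancyZ (2 * sg b) h))
  => [m|]; last by field.
rewrite !big_ord_recr big_ord0 /= add0r.
have [a0 a1 a2 a3] := v4 m; have [b0 b1 b2 b3] := v4 (m + b).
rewrite addr0 ![_ + _ + 4 * b]addrAC -mulrDr a0 a1 a2 a3 b0 b1 b2 b3 !sgD.
by ring: (sgsg m).
Qed.

(** * Dilation by 4 and the vectors of [C n] *)

(** All four residues reproduce the product at [m]: in residues 2 and 3 the four signs multiply to
    [sg (x + y + z)], and in residue 3 the four extra minus signs cancel. *)
Lemma corr4_dilate (x y z : int) (c : R) :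
  sg (x + y + z) = 1 ->
  corr4 [:: x; y; z] c -> corr4 [:: 4 * x; 4 * y; 4 * z] c.
Proof.
rewrite !sgD => xyz h; apply: (@bounded_discrepancy_blocks R 4) => // [i|].
  rewrite !big_cons big_nil mulr1.
  by do 3!(apply: normM_le1; first exact: norm_w); exact: norm_w.
apply: eq_bounded_discrepancy (bounded_discrepancyZ 4 h) => [m|//].
rewrite !big_ord_recr big_ord0 /= add0r.
rewrite !big_cons !big_nil !mulr1 addr0.
have [a0 a1 a2 a3] := w4 m; have [b0 b1 b2 b3] := w4 (m + x).
have [c0 c1 c2 c3] := w4 (m + y); have [d0 d1 d2 d3] := w4 (m + z).
rewrite ![_ + _ + 4 * x]addrAC ![_ + _ + 4 * y]addrAC ![_ + _ + 4 * z]addrAC.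
rewrite -!mulrDr a0 a1 a2 a3 b0 b1 b2 b3 c0 c1 c2 c3 d0 d1 d2 d3 !sgD.
by ring: (sgsg m) xyz.
Qed.

Lemma corr4_C (n m : nat) (l : int) (b := 2 ^+ n.+1 * (2 * l + 1)) :
  corr4 [seq 2 ^+ m * x | x <- [:: 1; b; b + 1]] (1 - 3 / 2 ^+ n.+1).
Proof.
have [k] := ubnP m; elim: k m => // k IH [|[|m]] mk.
- apply: eq_bounded_discrepancy (corr_u_pow n l) => // i.
  by rewrite /= expr0 !mul1r !big_cons big_nil mulr1 /u -/b !addrA !mulrA.
(* For [m = 1] the product is [v i * v (i + 2 * b)], and [2 * b] is 4 times [2 ^+ n * (2 * l + 1)].
   This last shift is odd exactly when [n = 0], which makes [c = 0] and the sign -1. *)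
- have [c [cE hc]] : exists c, sg (2 ^+ n * (2 * l + 1)) * (1 + c) / 2 =
      1 - 3 / 2 ^+ n.+1 /\
      bounded_discrepancy (fun i => u i * u (i + 2 ^+ n * (2 * l + 1))) c.
    case: n {b IH} => [|n].
      exists 0; split; first by rewrite mul1r sgD sg2 sg1; field.
      by apply: eq_bounded_discrepancy (corr_u_odd l) => // i; rewrite mul1r.
    exists (1 - 3 / 2 ^+ n.+1); split; last exact: corr_u_pow.
    rewrite (exprS (2 : int) n) -(mulrA (2 : int)) sg2 !exprS; field.
    by rewrite expf_neq0 ?pnatr_eq0.
  apply: eq_bounded_discrepancy (corr_v_4b hc) => // i.
  rewrite /= expr1 !big_cons big_nil !mulr1 /v -!mulrA.
  by congr (_ * (w _ * (w _ * w _))); rewrite /b exprS; ring.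
- have mk2 : (m < k)%N by lia.
  have := IH _ mk2; rewrite /= => /corr4_dilate h.
  have pow2S (x : int) : 2 ^+ m.+2 * x = 4 * (2 ^+ m * x) by rewrite !exprS; ring.
  apply: eq_bounded_discrepancy (h _) => // [i|].
    by rewrite /= !pow2S.
  (* The three shifts have even sum because [1 + b + (b + 1)] is twice [b + 1]. *)
  rewrite (_ : _ + _ + _ = 2 * (2 ^+ m * (b + 1))) ?sg2//; ring.
Qed.

End rudin_shapiro_correlations.

Theorem theorem6p6 (R : realType) (w : int -> R) (n : nat) :
  rudin_shapiro w -> (1 <= n)%N ->
  forall m1 m2 m3 : int, C n (m1, m2, m3) ->
    cvgn (avg4 w m1 m2 m3) /\ eta4 w m1 m2 m3 = 1 - 3 / 2 ^+ n.
Proof.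
(* From here on [n.+1] is the exponent of the statement. *)
case: n => // n wRS _ m1 m2 m3 [m [l /= mE]].
suff cvg_avg : avg4 w m1 m2 m3 @ \oo --> (1 - 3 / 2 ^+ n.+1 : R).
  by split; [apply/cvg_ex; exists (1 - 3 / 2 ^+ n.+1)|exact: cvg_lim].
apply: (@bounded_discrepancy_cvg R
  (fun i => w i * w (i + m1) * w (i + m2) * w (i + m3))).
apply: eq_bounded_discrepancy (corr4_C wRS n m l) => // i.
by rewrite -(perm_big _ mE) !big_cons big_nil /= mulr1 !mulrA.
Qed.
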